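(* The formal system ATM described in the context is consistent; that is, $\bot$ is not a theorem of ATM.
   Context: The formal system ATM is defined as follows. Terms: $\dot{\bot}$ and $L_1, L_2, L_3,\ldots$ are constant symbols, and each is a term. If $s,t$ are terms, then so are $(s\,\dot{\wedge}\,t)$, $(s\,\dot{\vee}\,t)$, $(s\,\dot{\to}\,t)$, $\dot{\mathbb{A}}[t]$, $\dot{\mathbb{T}}[t]$, $\dot{\mathbb{M}}[t]$. All terms arise this way; there are no variables. Abbreviations: $\dot{\neg}t$ is $t\,\dot{\to}\,\dot{\bot}$, and $s\,\dot{\leftrightarrow}\,t$ is $(s\,\dot{\to}\,t)\,\dot{\wedge}\,(t\,\dot{\to}\,s)$. Sentences: the atomic sentences are $\bot$ and $\mathbb{A}[t]$, $\mathbb{T}[t]$, $\mathbb{M}[t]$ for each term $t$. If $\phi,\psi$ are sentences, so are $(\phi\wedge\psi)$, $(\phi\vee\psi)$, $(\phi\to\psi)$. Abbreviations: $\neg\phi$ is $\phi\to\bot$, and $\phi\leftrightarrow\psi$ is $(\phi\to\psi)\wedge(\psi\to\phi)$. Quotation and evaluation: for a sentence $\phi$, $\dot{\phi}$ is the term obtained by putting dots on every $\bot,\wedge,\vee,\to,\mathbb{A},\mathbb{T},\mathbb{M}$ in $\phi$. Each term $t$ evaluates to a sentence $\hat{t}$: $\dot{\bot}$ evaluates to $\bot$; $\dot{\mathbb{A}}[t]$, $\dot{\mathbb{T}}[t]$, $\dot{\mathbb{M}}[t]$ evaluate to $\mathbb{A}[t]$, $\mathbb{T}[t]$, $\mathbb{M}[t]$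 respectively (with $t$ unchanged); $s\,\dot{\wedge}\,t$, $s\,\dot{\vee}\,t$, $s\,\dot{\to}\,t$ evaluate to $\hat{s}\wedge\hat{t}$, $\hat{s}\vee\hat{t}$, $\hat{s}\to\hat{t}$; and each $L_i$ evaluates to a fixed sentence $\theta_i$, where $\theta_1$ is $\neg\mathbb{T}[L_1]$, $\theta_2$ is $\neg\mathbb{A}[L_2]$, and the remaining $\theta_i$ ($i\ge 3$) are arbitrary fixed sentences. Thus $\hat{\dot{\phi}}=\phi$. Groundedness: the grounded sentences form the smallest set of sentences such that $\bot$ is grounded; $\mathbb{A}[t]$ and $\mathbb{M}[t]$ are grounded for every term $t$; if $\phi,\psi$ are grounded then so are $\phi\wedge\psi$, $\phi\vee\psi$, $\phi\to\psi$; and if $\hat{t}$ is grounded then $\mathbb{T}[t]$ is grounded. Logical axioms: all sentences $(\mathbb{M}[s]\wedge\mathbb{M}[t]\wedge\mathbb{M}[u])\to\mathbb{A}[\dot{A}(s,t,u)]$ for terms $s,t,u$, where $A$ ranges over the standard Hilbert-style axiom schemes of intuitionistic propositional logic and $\dot{A}(s,t,u)$ is the term obtained by instantiating the scheme with $s,t,u$ using the dotted connectives (e.g. $s\,\dot{\wedge}\,t\,\dot{\to}\,s$). Nonlogical axioms (for all terms $s,t,t'$): (1) $\mathbb{M}[t]$, whenever $\hat{t}$ is grounded; (2) $(\mathbb{M}[s]\wedge\mathbb{M}[t])\leftrightarrow\mathbb{M}[s\,\dot{\wedge}\,t]\leftrightarrow\mathbb{M}[s\,\dot{\vee}\,t]\leftrightarrow\mathbb{M}[s\,\dot{\to}\,t]$;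 (3) $\mathbb{A}[t]\to\mathbb{M}[t]$; (4) $(\mathbb{A}[s]\wedge\mathbb{A}[t])\to\mathbb{A}[s\,\dot{\wedge}\,t]$; (5) $(\mathbb{A}[s]\wedge\mathbb{A}[s\,\dot{\to}\,t])\to\mathbb{A}[t]$; (6) $\mathbb{M}[t]\to\mathbb{A}[t\,\dot{\to}\,\dot{\mathbb{A}}[t]]$; (7) $\mathbb{M}[t]\to\mathbb{A}[t\,\dot{\leftrightarrow}\,\dot{\mathbb{T}}[t]]$; (8) $\neg\mathbb{M}[t]\to\mathbb{A}[\dot{\neg}\dot{\mathbb{T}}[t]]$; (9) $\mathbb{M}[t]\to\mathbb{A}[t\,\dot{\leftrightarrow}\,t']$, whenever $\hat{t}=\hat{t}'$. Rules of inference: from $\phi$ and $\psi$ infer $\phi\wedge\psi$; from $\phi$ and $\phi\to\psi$ infer $\psi$ (modus ponens); from $\mathbb{A}[t]$ infer $\hat{t}$ (release). A theorem of ATM is a sentence derivable from the axioms by these rules. *)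

(* Defs.v *)
From Stdlib Require Import PArith.

(* The constants L_1, L_2, L_3, ... are indexed by [positive], so that
   [tL 1] is L_1. *)
Inductive term : Type :=
| tBot : term
| tL : positive -> term
| tAnd : term -> term -> term
| tOr : term -> term -> term
| tImp : term -> term -> term
| tA : term -> term
| tT : term -> term
| tM : term -> term.

Definition tNeg (t : term) : term := tImp t tBot.
Definition tIff (s t : term) : term := tAnd (tImp s t) (tImp t s).

Inductive sentence : Type :=
| Bot : sentence
| A : term -> sentence
| T : term -> sentence
| M : term -> sentence
| And : sentence -> sentence -> sentence
| Or : sentence -> sentence -> sentence
| Imp : sentence -> sentence -> sentence.

Definition Neg (phi : sentence) : sentence := Imp phi Bot.
Definition Iff (phi psi : sentence) : sentence :=
  And (Imp phi psi) (Imp psi phi).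

Fixpoint eval (theta : positive -> sentence) (t : term) : sentence :=
  match t with
  | tBot => Bot
  | tL i => theta i
  | tAnd s u => And (eval theta s) (eval theta u)
  | tOr s u => Or (eval theta s) (eval theta u)
  | tImp s u => Imp (eval theta s) (eval theta u)
  | tA s => A s
  | tT s => T s
  | tM s => M s
  end.

Inductive grounded (theta : positive -> sentence) : sentence -> Prop :=
| grounded_Bot : grounded theta Bot
| grounded_A : forall t, grounded theta (A t)
| grounded_M : forall t, grounded theta (M t)
| grounded_And : forall phi psi,
    grounded theta phi -> grounded theta psi -> grounded theta (And phi psi)
| grounded_Or : forall phi psi,
    grounded theta phi -> grounded theta psi -> grounded theta (Or phi psi)
| grounded_Imp : forall phi psi,
    grounded theta phi -> grounded theta psi -> grounded theta (Imp phi psi)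
| grounded_T : forall t,
    grounded theta (eval theta t) -> grounded theta (T t).

Inductive scheme : Type :=
| sK | sS | sAndL | sAndR | sAndI | sOrL | sOrR | sOrE | sExFalso.

(* A scheme with fewer than three metavariables ignores the extra terms. *)
Definition inst (c : scheme) (s t u : term) : term :=
  match c with
  | sK => tImp s (tImp t s)
  | sS => tImp (tImp s (tImp t u)) (tImp (tImp s t) (tImp s u))
  | sAndL => tImp (tAnd s t) s
  | sAndR => tImp (tAnd s t) t
  | sAndI => tImp s (tImp t (tAnd s t))
  | sOrL => tImp s (tOr s t)
  | sOrR => tImp t (tOr s t)
  | sOrE => tImp (tImp s u) (tImp (tImp t u) (tImp (tOr s t) u))
  | sExFalso => tImp tBot s
  end.

(* The chain of equivalences between M[s] /\ M[t], M[s /\ t], M[s \/ t] and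
   M[s -> t] is given by its three consecutive links [ax_M_and], [ax_M_or],
   [ax_M_imp].  The triple conjunction in [ax_logical] is associated to the
   left. *)
Inductive ATM_axiom (theta : positive -> sentence) : sentence -> Prop :=
| ax_logical : forall (c : scheme) (s t u : term),
    ATM_axiom theta (Imp (And (And (M s) (M t)) (M u)) (A (inst c s t u)))
| ax_M_grounded : forall t,
    grounded theta (eval theta t) -> ATM_axiom theta (M t)
| ax_M_and : forall s t,
    ATM_axiom theta (Iff (And (M s) (M t)) (M (tAnd s t)))
| ax_M_or : forall s t,
    ATM_axiom theta (Iff (M (tAnd s t)) (M (tOr s t)))
| ax_M_imp : forall s t,
    ATM_axiom theta (Iff (M (tOr s t)) (M (tImp s t)))
| ax_A_M : forall t,
    ATM_axiom theta (Imp (A t) (M t))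
| ax_A_and : forall s t,
    ATM_axiom theta (Imp (And (A s) (A t)) (A (tAnd s t)))
| ax_A_mp : forall s t,
    ATM_axiom theta (Imp (And (A s) (A (tImp s t))) (A t))
| ax_A_A : forall t,
    ATM_axiom theta (Imp (M t) (A (tImp t (tA t))))
| ax_A_T : forall t,
    ATM_axiom theta (Imp (M t) (A (tIff t (tT t))))
| ax_not_M : forall t,
    ATM_axiom theta (Imp (Neg (M t)) (A (tNeg (tT t))))
| ax_eval : forall t t',
    eval theta t = eval theta t' -> ATM_axiom theta (Imp (M t) (A (tIff t t'))).

Inductive ATM_theorem (theta : positive -> sentence) : sentence -> Prop :=
| thm_axiom : forall phi,
    ATM_axiom theta phi -> ATM_theorem theta phi
| thm_conj : forall phi psi,
    ATM_theorem theta phi -> ATM_theorem theta psi ->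
    ATM_theorem theta (And phi psi)
| thm_mp : forall phi psi,
    ATM_theorem theta phi -> ATM_theorem theta (Imp phi psi) ->
    ATM_theorem theta psi
| thm_release : forall t,
    ATM_theorem theta (A t) -> ATM_theorem theta (eval theta t).

(* Main.v *)
(** The proof is a Kripke model on the chain of worlds 0, 1, 2, ..., where
    world [n] sees the worlds [m <= n].  At world 0 every [A t] and every
    [M t] holds, so no [Neg (M t)] is forced anywhere.  At world [n + 1],
    [M t] says that [t] evaluates to a grounded sentence and [A t] that,
    moreover, this sentence is forced at world [n]: assertibility is the
    "later" modality.  Every theorem is grounded and forced at all worlds;
    release is sound because [A t] at world [n + 1] yields [t] at world [n].
    [Bot] is forced nowhere. *)

Require Import Defs.
From Stdlib Require Import PArith Arith Lia.

(* [value asserted meaningful earlier phi P]: the grounded sentence [phi] has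
   truth value [P] at a world where [A], [M] are interpreted by [asserted],
   [meaningful] and where [earlier] is forcing at the preceding world.  It is a
   relation because groundedness, being a proposition, does not support a
   definition of truth by recursion. *)
Inductive value (theta : positive -> sentence)
    (asserted meaningful : term -> Prop) (earlier : sentence -> Prop) :
    sentence -> Prop -> Prop :=
| value_Bot : value theta asserted meaningful earlier Bot False
| value_A : forall t,
    value theta asserted meaningful earlier (A t) (asserted t)
| value_M : forall t,
    value theta asserted meaningful earlier (M t) (meaningful t)
| value_T : forall t P,
    value theta asserted meaningful earlier (eval theta t) P ->
    value theta asserted meaningful earlier (T t) P
| value_And : forall phi psi P Q,
    value theta asserted meaningful earlier phi P ->
    value theta asserted meaningful earlier psi Q ->
    value theta asserted meaningful earlier (And phi psi) (P /\ Q)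
| value_Or : forall phi psi P Q,
    value theta asserted meaningful earlier phi P ->
    value theta asserted meaningful earlier psi Q ->
    value theta asserted meaningful earlier (Or phi psi) (P \/ Q)
| value_Imp : forall phi psi P Q,
    value theta asserted meaningful earlier phi P ->
    value theta asserted meaningful earlier psi Q ->
    value theta asserted meaningful earlier (Imp phi psi)
      (earlier (Imp phi psi) /\ (P -> Q)).

Definition holds (theta : positive -> sentence)
    (asserted meaningful : term -> Prop) (earlier : sentence -> Prop)
    (phi : sentence) : Prop :=
  exists P, value theta asserted meaningful earlier phi P /\ P.

(** Recursion on the world alone: [A t] concerns an arbitrary sentence [eval theta t], so it drops
    one world, while [value] handles [T] and the connectives within a world. Ungrounded sentences
    have no value and are forced nowhere. *)
Fixpoint forces (theta : positive -> sentence) (n : nat) : sentence -> Prop :=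
  match n with
  | 0 => holds theta (fun _ => True) (fun _ => True) (fun _ => True)
  | S m =>
      holds theta
        (fun t => grounded theta (eval theta t) /\
                  forces theta m (eval theta t))
        (fun t => grounded theta (eval theta t))
        (forces theta m)
  end.

Section Model.

Variable theta : positive -> sentence.

(** * Truth at a single world *)

Section World.

Variables (asserted meaningful : term -> Prop) (earlier : sentence -> Prop).

Local Notation val := (value theta asserted meaningful earlier).
Local Notation hold := (holds theta asserted meaningful earlier).

(** The shape of the sentence determines the last rule, so the proposition is built in only one way
    and Leibniz equality holds without propositional extensionality. *)
Lemma value_functional phi P Q : val phi P -> val phi Q -> P = Q.
Proof.
  intros HP; revert Q.
  induction HP as [| | |t P _ IH|phi psi P1 P2 _ IH1 _ IH2
                  |phi psi P1 P2 _ IH1 _ IH2|phi psi P1 P2 _ IH1 _ IH2];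
    intros R HR; inversion HR; subst; auto;
    now erewrite IH1, IH2 by eassumption.
Qed.

Lemma value_total phi : grounded theta phi -> exists P, val phi P.
Proof.
  induction 1 as [| | |phi psi _ [P HP] _ [Q HQ]|phi psi _ [P HP] _ [Q HQ]
                 |phi psi _ [P HP] _ [Q HQ]|t _ [P HP]];
    eexists; econstructor; eassumption.
Qed.

Lemma value_holds phi P : val phi P -> (hold phi <-> P).
Proof.
  intros HP; split.
  - intros [Q [HQ q]]; now rewrite (value_functional _ _ _ HP HQ).
  - intros p; now exists P.
Qed.

Lemma holds_Bot : ~ hold Bot.
Proof. intros H; now apply (value_holds Bot False) in H; [|constructor]. Qed.

Lemma holds_A t : hold (A t) <-> asserted t.
Proof. apply value_holds; constructor. Qed.

Lemma holds_M t : hold (M t) <-> meaningful t.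
Proof. apply value_holds; constructor. Qed.

Lemma holds_T t :
  grounded theta (eval theta t) -> (hold (T t) <-> hold (eval theta t)).
Proof.
  intros G; destruct (value_total _ G) as [P HP].
  rewrite (value_holds (T t) P) by now constructor.
  now rewrite (value_holds _ _ HP).
Qed.

Section Connectives.

Variables phi psi : sentence.
Hypotheses (Gphi : grounded theta phi) (Gpsi : grounded theta psi).

Lemma holds_And : hold (And phi psi) <-> hold phi /\ hold psi.
Proof.
  destruct (value_total _ Gphi) as [P HP], (value_total _ Gpsi) as [Q HQ].
  rewrite (value_holds _ _ (value_And _ _ _ _ _ _ _ _ HP HQ)).
  now rewrite (value_holds _ _ HP), (value_holds _ _ HQ).
Qed.

Lemma holds_Or : hold (Or phi psi) <-> hold phi \/ hold psi.
Proof.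
  destruct (value_total _ Gphi) as [P HP], (value_total _ Gpsi) as [Q HQ].
  rewrite (value_holds _ _ (value_Or _ _ _ _ _ _ _ _ HP HQ)).
  now rewrite (value_holds _ _ HP), (value_holds _ _ HQ).
Qed.

Lemma holds_Imp :
  hold (Imp phi psi) <-> earlier (Imp phi psi) /\ (hold phi -> hold psi).
Proof.
  destruct (value_total _ Gphi) as [P HP], (value_total _ Gpsi) as [Q HQ].
  rewrite (value_holds _ _ (value_Imp _ _ _ _ _ _ _ _ HP HQ)).
  now rewrite (value_holds _ _ HP), (value_holds _ _ HQ).
Qed.

End Connectives.

End World.

(** * Forcing along the chain of worlds *)

Local Notation gr := (grounded theta).
Local Notation ev := (eval theta).
Local Notation forced := (forces theta).

Lemma grounded_And_iff phi psi : gr (And phi psi) <-> gr phi /\ gr psi.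
Proof.
  split; [inversion 1; now split | intros [? ?]; now constructor].
Qed.

Lemma grounded_Or_iff phi psi : gr (Or phi psi) <-> gr phi /\ gr psi.
Proof.
  split; [inversion 1; now split | intros [? ?]; now constructor].
Qed.

Lemma grounded_Imp_iff phi psi : gr (Imp phi psi) <-> gr phi /\ gr psi.
Proof.
  split; [inversion 1; now split | intros [? ?]; now constructor].
Qed.

Lemma forces_Bot n : ~ forced n Bot.
Proof. destruct n; apply holds_Bot. Qed.

Lemma forces_A_0 t : forced 0 (A t).
Proof. now apply holds_A. Qed.

Lemma forces_M_0 t : forced 0 (M t).
Proof. now apply holds_M. Qed.

Lemma forces_A_S n t : forced (S n) (A t) <-> gr (ev t) /\ forced n (ev t).
Proof. apply holds_A. Qed.

Lemma forces_M_S n t : forced (S n) (M t) <-> gr (ev t).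
Proof. apply holds_M. Qed.

Lemma forces_T n t : gr (ev t) -> (forced n (T t) <-> forced n (ev t)).
Proof. destruct n; apply holds_T. Qed.

Lemma forces_And n phi psi :
  gr phi -> gr psi ->
  (forced n (And phi psi) <-> forced n phi /\ forced n psi).
Proof. destruct n; apply holds_And. Qed.

Lemma forces_Or n phi psi :
  gr phi -> gr psi ->
  (forced n (Or phi psi) <-> forced n phi \/ forced n psi).
Proof. destruct n; apply holds_Or. Qed.

(** Unwinding [earlier] down to world 0 turns the one-step clause for implication into the usual
    Kripke clause. *)
Lemma forces_Imp n phi psi :
  gr phi -> gr psi ->
  (forced n (Imp phi psi) <->
   forall m, m <= n -> forced m phi -> forced m psi).
Proof.
  intros Gphi Gpsi; induction n as [|n IH]; simpl; rewrite holds_Imp by auto.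
  - split.
    + intros [_ H] m Hm; now replace m with 0 by lia.
    + intros H; split; [exact I | exact (H 0 (le_n 0))].
  - rewrite IH; split.
    + intros [Hearlier Hnow] m Hm.
      destruct (Nat.eq_dec m (S n)) as [-> | ne]; [exact Hnow|].
      apply Hearlier; lia.
    + intros H; split; [intros m Hm; apply H; lia | exact (H (S n) (le_n _))].
Qed.

(** The inner induction on groundedness covers [T] and the connectives. The outer one on worlds is
    for [A t], whose truth depends on [ev t], possibly a more complex sentence, one world back. *)
Lemma forces_pred n phi : gr phi -> forced (S n) phi -> forced n phi.
Proof.
  revert phi; induction n as [|n IHn]; intros phi G;
    induction G as [|t|t|phi psi G1 IH1 G2 IH2|phi psi G1 IH1 G2 IH2
                   |phi psi G1 _ G2 _|t G IH];
    try (rewrite !forces_And by auto; tauto);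
    try (rewrite !forces_Or by auto; tauto);
    try (rewrite !forces_Imp by auto; intros H m Hm; apply H; lia);
    try (rewrite !forces_T by auto; exact IH);
    intros H.
  (* The [Bot] cases of the base and successor worlds. *)
  1, 4: now apply forces_Bot in H.
  - apply forces_A_0.
  - apply forces_M_0.
  - apply forces_A_S in H as [Gt H]; apply forces_A_S; auto.
  - now rewrite forces_M_S in *.
Qed.

Lemma forces_mono m n phi : m <= n -> gr phi -> forced n phi -> forced m phi.
Proof. induction 1; eauto using forces_pred. Qed.

Lemma forces_Imp_valid phi psi :
  gr phi -> gr psi -> (forall n, forced n phi -> forced n psi) ->
  forall n, forced n (Imp phi psi).
Proof. intros Gphi Gpsi H n; apply forces_Imp; auto. Qed.

(** World 0 forces every [A t], so only successor worlds need checking. *)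
Lemma forces_Imp_A phi t :
  gr phi ->
  (forall n, forced (S n) phi -> gr (ev t) /\ forced n (ev t)) ->
  forall n, forced n (Imp phi (A t)).
Proof.
  intros G H; apply forces_Imp_valid; [assumption | constructor |].
  intros [|n] Hn; [apply forces_A_0 | now apply forces_A_S, H].
Qed.

Lemma forces_Iff n phi psi :
  gr phi -> gr psi ->
  (forced n (Iff phi psi) <->
   forced n (Imp phi psi) /\ forced n (Imp psi phi)).
Proof. intros; apply forces_And; now constructor. Qed.

(** * Soundness of axioms and rules *)

Lemma grounded_inst c s t u :
  gr (ev s) -> gr (ev t) -> gr (ev u) -> gr (ev (inst c s t u)).
Proof. destruct c; simpl; repeat constructor; assumption. Qed.

Lemma forces_inst c s t u n :
  gr (ev s) -> gr (ev t) -> gr (ev u) -> forced n (ev (inst c s t u)).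
Proof.
  intros Gs Gt Gu; destruct c; simpl;
    rewrite forces_Imp by (repeat constructor; assumption); intros m Hm H1;
    rewrite ?forces_Imp by (repeat constructor; assumption).
  - intros k Hk _; eauto using forces_mono.
  - intros k Hk H2; rewrite forces_Imp in * by (repeat constructor; assumption).
    intros j Hj H3.
    specialize (H1 j ltac:(lia) H3).
    rewrite forces_Imp in H1 by auto.
    apply (H1 j (le_n j)), (H2 j Hj H3).
  - now apply forces_And in H1.
  - now apply forces_And in H1.
  - intros k Hk H2; apply forces_And; eauto using forces_mono.
  - apply forces_Or; auto.
  - apply forces_Or; auto.
  - intros k Hk H2; rewrite forces_Imp in * by (repeat constructor; assumption).
    intros j Hj H3; apply forces_Or in H3 as [H3|H3]; auto.
    apply H1; [lia | exact H3].
  - now apply forces_Bot in H1.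
Qed.

(** Outside quoted terms, axioms contain only [A], [M] and [Bot] as atoms; [T] never occurs
    there. *)
Lemma grounded_ATM_axiom phi : ATM_axiom theta phi -> gr phi.
Proof. destruct 1; repeat constructor. Qed.

Lemma forces_ATM_axiom phi : ATM_axiom theta phi -> forall n, forced n phi.
Proof.
  destruct 1 as [c s t u|t Gt|s t|s t|s t|t|s t|s t|t|t|t|t t' E].
  - apply forces_Imp_A; [repeat constructor|]; intros n H.
    rewrite !forces_And, !forces_M_S in H by repeat constructor.
    destruct H as [[Gs Gt] Gu]; auto using grounded_inst, forces_inst.
  - intros [|n]; [apply forces_M_0 | now apply forces_M_S].
  (* For this and the next two axioms, successor worlds reduce to the fact that a compound is
     grounded exactly when both components are. *)
  - intros n; apply forces_Iff; [repeat constructor..|].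
    split; revert n; apply forces_Imp_valid; try solve [repeat constructor];
      intros [|n]; rewrite forces_And, ?forces_M_S by constructor;
      auto using forces_M_0; simpl; now rewrite grounded_And_iff.
  - intros n; apply forces_Iff; [repeat constructor..|].
    split; revert n; apply forces_Imp_valid; try solve [repeat constructor];
      intros [|n]; rewrite ?forces_M_S; auto using forces_M_0; simpl;
      now rewrite grounded_And_iff, grounded_Or_iff.
  - intros n; apply forces_Iff; [repeat constructor..|].
    split; revert n; apply forces_Imp_valid; try solve [repeat constructor];
      intros [|n]; rewrite ?forces_M_S; auto using forces_M_0; simpl;
      now rewrite grounded_Imp_iff, grounded_Or_iff.
  - apply forces_Imp_valid; [constructor..|].
    intros [|n]; rewrite ?forces_M_S, ?forces_A_S; [|tauto].
    intros _; apply forces_M_0.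
  - apply forces_Imp_A; [repeat constructor|]; intros n H.
    rewrite !forces_And, !forces_A_S in H by constructor.
    destruct H as [[Gs Hs] [Gt Ht]]; split; [now constructor|].
    now apply forces_And.
  - apply forces_Imp_A; [repeat constructor|]; intros n H.
    rewrite !forces_And, !forces_A_S in H by constructor; simpl in H.
    destruct H as [[Gs Hs] [Gst Hst]].
    apply grounded_Imp_iff in Gst as [_ Gt]; split; [exact Gt|].
    rewrite forces_Imp in Hst by auto; auto.
  - apply forces_Imp_A; [constructor|]; intros n Gt; simpl.
    rewrite forces_M_S in Gt; split; [repeat constructor; auto|].
    (* Persistence is what validates [t] implies [A t]: truth at a world passes to the preceding
       one. *)
    revert n; apply forces_Imp_A; auto using forces_pred.
  - apply forces_Imp_A; [constructor|]; intros n Gt; simpl.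
    rewrite forces_M_S in Gt; split; [repeat constructor; auto|].
    apply forces_Iff; [repeat constructor; auto..|].
    split; revert n; apply forces_Imp_valid; try (repeat constructor; auto);
      intros n; now rewrite forces_T.
  - apply forces_Imp_A; [repeat constructor|]; intros n H.
    unfold Neg in H; rewrite forces_Imp in H by constructor.
    (* A forced [Neg (M t)] would also apply at world 0, where [M t] holds. *)
    now elim (forces_Bot 0); apply H; [lia | apply forces_M_0].
  - apply forces_Imp_A; [constructor|]; intros n Gt; simpl.
    rewrite forces_M_S in Gt; rewrite <- E; split; [repeat constructor; auto|].
    apply forces_Iff; [auto..|].
    split; revert n; apply forces_Imp_valid; auto.
Qed.

(** Groundedness is carried through the induction because the forcing clauses for the connectives
    require it. *)
Lemma ATM_sound phi : ATM_theorem theta phi -> gr phi /\ forall n, forced n phi.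
Proof.
  induction 1 as [phi H|phi psi _ [G1 H1] _ [G2 H2]
                 |phi psi _ [_ H1] _ [G2 H2]|t _ [_ H]].
  - auto using grounded_ATM_axiom, forces_ATM_axiom.
  - split; [now constructor|]; intros n; apply forces_And; auto.
  - apply grounded_Imp_iff in G2 as [Gphi Gpsi]; split; [exact Gpsi|].
    intros n; specialize (H2 n); rewrite forces_Imp in H2 by auto; auto.
  (* World 1 is the first where [A t] carries information, so groundedness is read off there. Truth
     at [n] comes from world [n + 1], hence the need for a chain without a last index. *)
  - split; [exact (proj1 (proj1 (forces_A_S 0 t) (H 1)))|].
    intros n; exact (proj2 (proj1 (forces_A_S n t) (H (S n)))).
Qed.

End Model.

Theorem theorem4p1 (theta : positive -> sentence)
  (theta1 : theta 1%positive = Neg (T (tL 1%positive)))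
  (theta2 : theta 2%positive = Neg (A (tL 2%positive))) :
  ~ ATM_theorem theta Bot.
Proof.
  intros H; exact (forces_Bot theta 0 (proj2 (ATM_sound theta Bot H) 0)).
Qed.
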